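(* Let $G$ be a graph with $\chi(G) \geq 2$ and let $t$ be the unique integer for which $2^t < \chi(G) \le 2^{t+1}$. If there is a forest $F$ of $G$ (a set of edges of $G$ containing no cycle) with $\chi(G - F) \le 2^t$, then there is an integer $\ell < 2^{|F|-1}$, depending only on $G$, such that $\mathrm{ex}(\{M(G)\},n) = 2^n(1-2^{-t}) + \ell$ for all sufficiently large $n$.
   Context: A matroid of dimension $m$ is a set $M \subseteq \mathbb{F}_2^m \setminus \{0\}$. A subset of $M \subseteq \mathbb{F}_2^m$ that is the image of $N \subseteq \mathbb{F}_2^k$ under an injective linear map $\mathbb{F}_2^k \to \mathbb{F}_2^m$ is an $N$-restriction of $M$; $M$ is $N$-free if it has no $N$-restriction. $\mathrm{ex}(\{N\},n)$ is the maximum size of an $n$-dimensional $N$-free matroid. For a simple graph $G = (V,E)$, $M(G) \subseteq \mathbb{F}_2^V$ is the matroid consisting of the columns of the $V \times E$ incidence matrix of $G$ over $\mathbb{F}_2$. $\chi(G)$ is the chromatic number of $G$, and $G - F$ is the graph obtained from $G$ by deleting the edges in $F$; $|F|$ is the number of edges of $F$. *)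

(* Defs.v *)
From HB Require Import structures.
From mathcomp Require Import all_boot all_order all_algebra.
From mathcomp Require Import boolp.

Set Implicit Arguments.
Unset Strict Implicit.
Unset Printing Implicit Defensive.

Import GRing.Theory.

Record sgraph := SGraph {
  vertex :> finType;
  adj : rel vertex;
  adj_sym : symmetric adj;
  adj_irrefl : irreflexive adj }.

(* An edge is the two-element set of its ends. *)
Definition edges (G : sgraph) : {set {set G}} :=
  [set [set p.1; p.2] | p : G * G & adj p.1 p.2].

Section DeleteEdges.
Variables (G : sgraph) (F : {set {set G}}).

Definition del_rel : rel G :=
  [rel x y | adj x y && ([set x; y] \notin F)].

Lemma del_rel_sym : symmetric del_rel.
Proof. by move=> x y; rewrite /del_rel /= adj_sym setUC. Qed.

Lemma del_rel_irrefl : irreflexive del_rel.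
Proof. by move=> x; rewrite /del_rel /= adj_irrefl. Qed.

Definition del_edges : sgraph := SGraph del_rel_sym del_rel_irrefl.

End DeleteEdges.

Definition colorable (G : sgraph) (k : nat) : bool :=
  [exists c : {ffun G -> 'I_k},
    [forall x, forall y, adj x y ==> (c x != c y)]].

Lemma colorable_ex (G : sgraph) : exists k, colorable G k.
Proof.
exists #|G|; apply/existsP; exists [ffun x => enum_rank x].
apply/'forall_forallP => x y; apply/implyP => xy; rewrite !ffunE.
by apply: contraL xy => /eqP/enum_rank_inj->; rewrite adj_irrefl.
Qed.

Definition chromatic_number (G : sgraph) : nat := ex_minn (colorable_ex G).

(* A cycle is given by its cyclic sequence of at least three distinct
   vertices. *)
Definition forest (G : sgraph) (F : {set {set G}}) : Prop :=
  F \subset edges G /\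
  forall c : seq G, 2 < size c -> ~ ucycle [rel x y | [set x; y] \in F] c.

Definition matroid (m : nat) (M : {set 'cV['F_2]_m}) : bool := 0%R \notin M.

Definition has_restriction (k m : nat)
    (N : {set 'cV['F_2]_k}) (M : {set 'cV['F_2]_m}) : Prop :=
  exists f : {linear 'cV['F_2]_k -> 'cV['F_2]_m},
    injective f /\ f @: N \subset M.

Definition restriction_free (k m : nat)
    (N : {set 'cV['F_2]_k}) (M : {set 'cV['F_2]_m}) : Prop :=
  ~ has_restriction N M.

(* The maximum over an empty family is 0; this only matters for N = set0,
   since the empty matroid is N-free for every other N. *)
Definition ex_number (k : nat) (N : {set 'cV['F_2]_k}) (n : nat) : nat :=
  \max_(M : {set 'cV['F_2]_n} | matroid M && `[< restriction_free N M >]) #|M|.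

(* Rows and columns are indexed by vertices and edges through enum_val. *)
Definition incidence_matrix (G : sgraph) : 'M['F_2]_(#|G|, #|edges G|) :=
  (\matrix_(i, j) ((enum_val i : G) \in (enum_val j : {set G}))%:R)%R.

Definition graphic_matroid (G : sgraph) : {set 'cV['F_2]_#|G|} :=
  [set col j (incidence_matrix G) | j : 'I_#|edges G|].

(* Main.v *)
(** Write K for the complement of M. The engine is Hilbert's cube lemma: over F_2
a cube is an affine subspace, so a dense set contains large affine subspaces.
Iterating it gives a geometric Erdos-Stone theorem, in which the deleted
subspace W of the Bose-Burton geometry (C + W) \ W can be chosen inside any
prescribed large subspace.

For stability, let M have density at least 1 - 2^-t and contain no such geometry
with dim C = t + 1. If K meets K + x in positive density for a dense set of x in
M, a cube x + U of such x exists, Erdos-Stone applied to K :|: (K + x) inside U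
gives a geometry with dim C = t, and adjoining x to C is a contradiction. So K
is almost closed under addition, and hence close to a subspace W of codimension
t.

Colouring G - F with 2^t colours, |F| independent elements of M inside W would
give an M(G)-restriction, because the incidence vectors of a forest are
independent. So M has fewer than 2^(|F|-1) elements inside W. Cutting M with a
hyperplane that contains these elements but not W shows that the excess
ex(n) - 2^n (1 - 2^-t) is eventually nonincreasing, hence eventually constant. *)

Require Import Defs.
From HB Require Import structures.
From mathcomp Require Import all_boot all_order all_algebra.
From mathcomp Require Import boolp zify.

Set Implicit Arguments.
Unset Strict Implicit.
Unset Printing Implicit Defensive.

Import Order.TTheory GRing.Theory Num.Theory.

Local Notation vec n := 'cV['F_2]_n.

(** * Binary vector spaces and affine cubes *)

Section BinaryVectors.
Variable n : nat.
Implicit Types (x y b : vec n) (A B S : {set vec n}) (U C W : {vspace vec n}).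
Local Open Scope ring_scope.

Lemma F2_cases (a : 'F_2) : a = 0 \/ a = 1.
Proof. by case: a => [[|[|//]]] ?; [left | right]; apply: val_inj. Qed.

Lemma vec_addxx x : x + x = 0.
Proof. by apply/matrixP => i j; rewrite !mxE; case: (F2_cases (x i j)) => ->; apply: val_inj. Qed.

Lemma vec_opp x : - x = x.
Proof. by apply/esym/eqP; rewrite -subr_eq0 opprK vec_addxx. Qed.

Lemma vec_addrK x y : y + x + x = y.
Proof. by rewrite -addrA vec_addxx addr0. Qed.

Lemma card_vec : #|{: vec n}| = (2 ^ n)%N.
Proof. by rewrite card_mx card_Fp // muln1. Qed.

Lemma card_vspace2 U : #|[set x | x \in U]| = (2 ^ \dim U)%N.
Proof.
pose f (c : {ffun 'I_(\dim U) -> 'F_2}) : vec n := \sum_i c i *: (vbasis U)`_i.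
have inj_f : injective f.
  move=> c d /eqP; rewrite -subr_eq0 /f -sumrB => /eqP e.
  have := basis_free (vbasisP U) => /freeP/(_ (fun i => c i - d i)) h.
  apply/ffunP => i; apply/eqP; rewrite -subr_eq0; apply/eqP; apply: h.
  by rewrite -[RHS]e; apply: eq_bigr => j _; rewrite scalerBl.
have <- : #|{ffun 'I_(\dim U) -> 'F_2}| = (2 ^ \dim U)%N.
  by rewrite card_ffun card_Fp // card_ord.
rewrite -cardsT -(card_imset _ inj_f); apply: eq_card => x; rewrite inE.
apply/idP/imsetP => [xU|[c _ ->]].
  by exists [ffun i => coord (vbasis U) i x] => //; rewrite {1}(coord_vbasis xU);
     apply: eq_bigr => i _; rewrite ffunE.
by apply: memv_suml => i _; apply/memvZ/vbasis_mem/mem_nth; rewrite size_tuple.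
Qed.

Lemma dimv_vec : \dim (fullv : {vspace vec n}) = n.
Proof. by rewrite dimvf /dim /= muln1. Qed.

Lemma mem_addv_line C b x : (x \in (C + <[b]>)%VS) = (x \in C) || (x + b \in C).
Proof.
apply/memv_addP/orP => [[c cC [_ /vlineP[a ->] ->]]|].
  by case: (F2_cases a) => ->; rewrite ?scale0r ?scale1r ?addr0 ?vec_addrK; [left|right].
case=> [xC|xbC]; first by exists x => //; exists 0; rewrite ?mem0v ?addr0.
by exists (x + b) => //; exists b; rewrite ?memv_line ?vec_addrK.
Qed.

Lemma dim_addv_line C b : b \notin C -> \dim (C + <[b]>)%VS = (\dim C).+1.
Proof.
move=> bC; rewrite dimv_disjoint_sum ?dim_vline.
  by case: eqP bC => [->|_]; rewrite ?mem0v // addn1.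
apply/eqP; rewrite -subv0; apply/subvP => x; rewrite memv_cap memv0 => /andP[xC].
case/vlineP=> a e; move: xC; rewrite e; case: (F2_cases a) => ->; rewrite ?scale0r ?eqxx //.
by rewrite scale1r (negbTE bC).
Qed.

Lemma exists_subspace U k : (k <= \dim U)%N ->
  exists2 W : {vspace vec n}, (W <= U)%VS & \dim W = k.
Proof.
move=> kU; pose X := take k (vbasis U).
have fX : free X.
  by have := basis_free (vbasisP U); rewrite -{1}(cat_take_drop k (vbasis U)) => /catl_free.
exists <<X>>%VS; last by rewrite (eqP fX) size_takel ?size_tuple.
by apply/span_subvP => x /mem_take/vbasis_mem.
Qed.

Lemma exists_superspace U W k : (U <= W)%VS -> (\dim U <= k <= \dim W)%N ->
  exists V : {vspace vec n}, [/\ (U <= V)%VS, (V <= W)%VS & \dim V = k].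
Proof.
move=> UW /andP[Uk kW].
have dW : (\dim U + \dim (W :\: U) = \dim W)%N.
  by have := dimv_cap_compl W U; rewrite (capv_idPr UW).
have [|V VW dV] := @exists_subspace (W :\: U)%VS (k - \dim U)%N; first lia.
have VcapU : (U :&: V)%VS = 0%VS.
  apply/eqP; rewrite -subv0; apply: subv_trans (capvS (subvv U) VW) _.
  by rewrite capvC capv_diff.
exists (U + V)%VS; rewrite addvSl subv_add UW (subv_trans VW (diffvSl _ _)); split=> //.
by rewrite dimv_disjoint_sum // dV; lia.
Qed.

(** In characteristic 2 this preimage is the translate of [A] by [x]. *)
Definition shift A x : {set vec n} := [set y | y + x \in A].

Lemma in_shift A x y : (y \in shift A x) = (y + x \in A).
Proof. by rewrite inE. Qed.

Lemma shift_imset A x : shift A x = +%R^~ x @: A.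
Proof.
apply/setP => y; rewrite inE; apply/idP/imsetP => [yA|[z zA ->]]; last by rewrite vec_addrK.
by exists (y + x); rewrite ?vec_addrK.
Qed.

Lemma card_shift A x : #|shift A x| = #|A|.
Proof. by rewrite shift_imset card_imset //; apply: addIr. Qed.

(** A pair (a, b) in A x B is counted for exactly one shift, x = a + b. *)
Lemma sum_card_shiftI A B : (\sum_x #|A :&: shift B x| = #|A| * #|B|)%N.
Proof.
under eq_bigr => x _ do rewrite -sum1_card big_mkcond /=.
rewrite exchange_big /= -sum_nat_const [RHS]big_mkcond /=; apply: eq_bigr => y _.
case: ifP => yA; last by rewrite big1 // => x _; rewrite inE yA.
rewrite -(card_shift B y) -sum1_card [RHS]big_mkcond /=; apply: eq_bigr => x _.
by rewrite !inE yA addrC.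
Qed.

End BinaryVectors.

Lemma dense_coset n (W : {vspace vec n}) (Y : {set vec n}) e :
  2 ^ n <= e * #|Y| ->
  exists b, 2 ^ \dim W <= e * #|[set w | (w \in W) && ((b + w)%R \in Y)]|.
Proof.
move=> hY; apply: contrapT => /forallNP h.
have {}h b : e * #|[set w | w \in W] :&: shift Y b| < 2 ^ \dim W.
  rewrite ltnNge; apply/negP => hb; case: (h b).
  apply: leq_trans hb _; rewrite leq_mul2l; apply/orP; right; apply: subset_leq_card.
  by apply/subsetP => w; rewrite !inE addrC.
(* Averaging: the translates of [Y] meet [W] in |W||Y| points altogether. *)
have := @sum_card_shiftI n [set w | w \in W] Y; rewrite card_vspace2 => s.
have : e * \sum_b #|[set w | w \in W] :&: shift Y b| < 2 ^ n * 2 ^ \dim W.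
  rewrite big_distrr /= -card_vec -sum_nat_const.
  apply: (@leq_ltn_trans (\sum_(b : vec n) (2 ^ \dim W).-1)).
    by apply: leq_sum => b _; rewrite -ltnS prednK ?expn_gt0 ?h.
  by rewrite !sum_nat_const ltn_mul2l card_vec !expn_gt0 /= prednK ?expn_gt0.
by rewrite s; apply/negP; rewrite -leqNgt mulnCA [leqLHS]mulnC leq_mul2l hY orbT.
Qed.

(* Hilbert's cube lemma over F_2, where cubes are affine subspaces. *)
Lemma affine_cube k e : 0 < e -> exists D, forall n (U : {vspace vec n}) (S : {set vec n}),
  D <= \dim U -> 2 ^ \dim U <= e * #|S| -> {subset S <= U} ->
  exists b (W : {vspace vec n}),
    [/\ (W <= U)%VS, \dim W = k & forall w, w \in W -> (b + w)%R \in S].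
Proof.
elim: k e => [|k IHk] e e0.
  exists 0 => n U S _ dS SU.
  have /card_gt0P[b bS] : 0 < #|S|.
    by move: dS; case: #|S| => //; rewrite muln0 leqn0 expn_eq0.
  exists b, 0%VS; split; rewrite ?sub0v ?dimv0 // => w; rewrite memv0 => /eqP->.
  by rewrite addr0.
have [|D HD] := IHk (2 * e ^ 2); first by rewrite muln_gt0 expn_gt0 e0.
(* [D.+1] leaves dimension at least [D] after one direction is split off. [2 * e] forces two points
   in [S], so the zero direction accounts for at most half of the |S|^2 pairs. *)
exists (D.+1 + 2 * e) => n U S dU dS SU.
have eU : 2 * e < 2 ^ \dim U.
  by apply: leq_ltn_trans (ltn_expl (\dim U) (isT : 1 < 2)); lia.
have S2 : 2 <= #|S|.
  by rewrite leqNgt; apply/negP => hS; move: dS eU; nia.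
(* The other half of the pairs is spread over the nonzero vectors of [U], so some [h] has an overlap
   of density at least 1/(2e^2). *)
have [h [hU h0 hS]] : exists h, [/\ h \in U, h != 0%R & 2 ^ \dim U <= 2 * e ^ 2 * #|S :&: shift S h|].
  apply: contrapT => /forallNP hh.
  have s := @sum_card_shiftI n S S.
  rewrite (bigD1 (0 : vec n)%R) //= in s.
  have e1 : #|S :&: shift S 0%R| <= #|S| by apply/subset_leq_card/subsetIl.
  have e2 : 2 * e ^ 2 * \sum_(x | x != 0%R) #|S :&: shift S x| <= 2 ^ \dim U * (2 ^ \dim U).-1.
    rewrite big_distrr /=.
    have cU : #|[set x in U | x != 0%R]| = (2 ^ \dim U).-1.
      rewrite -card_vspace2 [in RHS](cardsD1 0%R) inE mem0v /=; apply: eq_card => x.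
      by rewrite !inE andbC.
    rewrite -cU [leqRHS]mulnC -sum_nat_const [leqRHS]big_mkcond [leqLHS]big_mkcond /=.
    apply: leq_sum => x _; rewrite inE; case: (eqVneq x 0%R) => /=; first by rewrite andbF.
    move=> x0; rewrite andbT; case: ifP => xU.
      by have := hh x; rewrite xU x0; case: (leqP (2 ^ \dim U)) => [? []//|/ltnW].
    rewrite (_ : S :&: _ = set0) ?cards0 ?muln0 //; apply/setP => y; rewrite !inE.
    by apply/negP => /andP[/SU yU /SU]; rewrite rpredDl ?xU.
  move: s e2; move: (\sum_(_ | _) _) => T s e2.
  have h0 : 2 * #|S| <= #|S| * #|S| by rewrite leq_mul2r S2 orbT.
  have h1 : #|S| * #|S| <= 2 * T.
    by move: e1 s h0; move: #|_ :&: _| (#|S| * #|S|) #|S|; lia.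
  have h2 := leq_mul dS dS.
  have h3 : e ^ 2 * (#|S| * #|S|) <= e ^ 2 * (2 * T) by rewrite leq_mul2l h1 orbT.
  have h4 : 2 ^ \dim U * (2 ^ \dim U).-1 < 2 ^ \dim U * 2 ^ \dim U.
    by rewrite ltn_mul2l expn_gt0 /= prednK ?expn_gt0.
  by move: e2 h2 h3 h4; rewrite -!mulnn; set u := 2 ^ _; lia.
set T := S :&: _ in hS.
pose U' := (U :\: <[h]>)%VS.
have hU' : h \notin U'.
  apply/negP => hh; have : h \in (U' :&: <[h]>)%VS by rewrite memv_cap hh memv_line.
  by rewrite capv_diff memv0 (negbTE h0).
have UE : (U' + <[h]> = U)%VS.
  by rewrite addv_diff; apply/addv_idPl; rewrite -memvE.
have dU' : \dim U = (\dim U').+1 by rewrite -{1}UE dim_addv_line.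
(* [T] is invariant under [h] and [U] is the union of [U'] and its translate by [h], so [T] keeps
   its density inside [U']. A cube found there can be doubled along [h]. *)
have cT : #|T| <= 2 * #|[set x in T | x \in U']|.
  rewrite mul2n -addnn -[X in _ + X](card_shift _ h); apply: leq_trans (leq_card_setU _ _).
  apply/subset_leq_card/subsetP => x; rewrite !inE => /andP[xS xhS].
  rewrite xS xhS vec_addrK /= xS /=.
  by have := SU _ xS; rewrite -{1}UE mem_addv_line.
have [||x|b [W [WU dW bW]]] := HD n U' [set x in T | x \in U'].
- by lia.
- by move: hS; rewrite dU' expnS; nia.
- by rewrite inE => /andP[].
have hW : h \notin W by apply: contra hU'; apply/subvP.
exists b, (W + <[h]>)%VS; split.
- by rewrite -UE; apply: addvS.
- by rewrite dim_addv_line ?dW.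
move=> w; rewrite mem_addv_line => /orP[] /bW; rewrite !inE => /andP[/andP[//]].
by rewrite -!addrA vec_addxx addr0.
Qed.

(** * Sumsets and the geometric Erdos-Stone theorem *)

Section Sumsets.
Variable n : nat.
Implicit Types (A B C S : {set vec n}) (x y : vec n).

Definition sumset A B : {set vec n} := [set (a + b)%R | a in A, b in B].

Lemma card_sumset A B : #|sumset A B| <= #|A| * #|B|.
Proof. by rewrite /sumset curry_imset2X (leq_trans (leq_imset_card _ _)) ?cardsX. Qed.

Lemma card_shiftI_sym A B x : #|A :&: shift B x| = #|B :&: shift A x|.
Proof.
rewrite -(card_shift (B :&: _) x); apply: eq_card => y.
by rewrite !inE vec_addrK andbC.
Qed.

(** Both sides count the triples (a, b, c) in A x B x C with a + b = c. *)
Lemma sum_card_shiftI_sym A B C :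
  \sum_(x in A) #|B :&: shift C x| = \sum_(x in C) #|B :&: shift A x|.
Proof.
have I (P Q : {set vec n}) : #|P :&: Q| = \sum_(y in P) (y \in Q).
  rewrite -sum1_card big_mkcond [RHS]big_mkcond; apply: eq_bigr => y _.
  by rewrite inE; case: (y \in P); case: (y \in Q).
have E (D D' : {set vec n}) :
    \sum_(x in D) #|B :&: shift D' x| = \sum_(b in B) #|D :&: shift D' b|.
  under eq_bigr do rewrite I; under [RHS]eq_bigr do rewrite I.
  rewrite exchange_big; apply: eq_bigr => b _; apply: eq_bigr => x _.
  by rewrite !in_shift addrC.
by rewrite !E; apply: eq_bigr => b _; rewrite card_shiftI_sym.
Qed.

Lemma closed_vspace S : 0%R \in S -> {in S &, forall x y, (x + y)%R \in S} ->
  exists W : {vspace vec n}, W =i S.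
Proof.
move=> S0 SD; exists <<enum S>>%VS => x; apply/idP/idP; last first.
  by move=> xS; apply: memv_span; rewrite mem_enum.
move/(@coord_span _ _ _ (in_tuple (enum S))) ->; apply: (big_ind (fun x => x \in S)) => // i _.
case: (F2_cases (coord (in_tuple (enum S)) i x)) => ->; rewrite ?scale0r // scale1r.
by rewrite -mem_enum mem_nth.
Qed.

(** For z = a + b the translates S + a and S + b both lie in S + S, so they overlap in more than
    half of |S|: z is a difference of elements of [S] in more than |S|/2 ways. Two such y, z share
    some x with x, x + y, x + z in [S], whence y + z is in S + S. *)
Lemma small_doubling_vspace S : 0%R \in S -> 2 * #|sumset S S| < 3 * #|S| ->
  exists W : {vspace vec n}, W =i sumset S S.
Proof.
move=> S0 SS; apply: closed_vspace; first by apply/imset2P; exists 0%R 0%R; rewrite ?addr0.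
have half z : z \in sumset S S -> #|S| < 2 * #|S :&: shift S z|.
  case/imset2P=> a b aS bS ->.
  rewrite -(card_shift (_ :&: _) a).
  have -> : shift (S :&: shift S (a + b)%R) a = shift S a :&: shift S b.
    by apply/setP => y; rewrite !inE -addrA [(a + (a + b))%R]addrA vec_addxx add0r.
  have := cardsUI (shift S a) (shift S b); rewrite !card_shift.
  have : #|shift S a :|: shift S b| <= #|sumset S S|.
    apply/subset_leq_card/subsetP => y; rewrite !inE => /orP[] yS.
      by apply/imset2P; exists (y + a)%R a; rewrite ?vec_addrK.
    by apply/imset2P; exists (y + b)%R b; rewrite ?vec_addrK.
  by lia.
move=> y z /half hy /half hz.
have /card_gt0P[x] : 0 < #|(S :&: shift S y) :&: (S :&: shift S z)|.
  have := cardsUI (S :&: shift S y) (S :&: shift S z).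
  have : #|(S :&: shift S y) :|: (S :&: shift S z)| <= #|S|.
    by apply/subset_leq_card; rewrite subUset !subsetIl.
  by lia.
rewrite !inE => /andP[/andP[_ h1] /andP[_ h2]].
apply/imset2P; exists (x + y)%R (x + z)%R => //.
by rewrite addrACA vec_addxx add0r.
Qed.

End Sumsets.

(* The complement of K contains the Bose-Burton geometry (C + W) \ W; when 0 is
   in K this forces C and W to be independent. *)
Definition avoids n (K : {set vec n}) (C W : {vspace vec n}) : Prop :=
  forall c w, c \in C -> w \in W -> c != 0%R -> (c + w)%R \notin K.

Lemma avoids_extend n (K : {set vec n}) (C W W' : {vspace vec n}) b :
  avoids K C W -> (W' <= W)%VS ->
  (forall c w, c \in C -> w \in W' -> (b + c + w)%R \notin K) ->
  avoids K (C + <[b]>)%VS W'.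
Proof.
move=> av W'W bK c w; rewrite mem_addv_line => /orP[cC|cbC] wW c0.
  by apply: av => //; apply: (subvP W'W).
by have := bK _ _ cbC wW; rewrite [(b + _)%R]addrC vec_addrK.
Qed.

(** The numerical hypothesis says that [K] has density at most 2^(1-i) - 1/e. In the step from i to
    i + 1, C + K has density at most 2^i |K| / 2^n, so its complement [Y] has density at least 1/e.
    An affine cube of [Y] in a coset of [W] then supplies both the new vector of [C] and the smaller
    [W']. *)
Lemma geometric_erdos_stone e k i : 0 < e ->
  exists D, forall n (K : {set vec n}) (U : {vspace vec n}),
    0%R \in K -> D <= \dim U -> e * 2 ^ i * #|K| + 2 ^ i * 2 ^ n <= 2 * e * 2 ^ n ->
    exists C W : {vspace vec n},
      [/\ (W <= U)%VS, \dim W = k, \dim C = i & avoids K C W].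
Proof.
move=> e0; elim: i k => [|i IHi] k.
  exists k => n K U _ /exists_subspace[W WU dW] _; exists 0%VS, W; rewrite dimv0; split=> //.
  by move=> c w; rewrite memv0 => ->.
have [D1 HD1] := affine_cube k e0; have [D HD] := IHi D1; exists D => n K U K0 dU dK.
have [|C [W [WU dW dC av]]] := HD n K U K0 dU.
  by move: dK; rewrite expnS; nia.
set Y := ~: sumset [set x | x \in C] K.
have YE y c : y \in Y -> c \in C -> (y + c)%R \notin K.
  rewrite inE => yY cC; apply: contra yY => ycK; apply/imset2P.
  by exists c (y + c)%R; rewrite ?inE // addrC vec_addrK.
have cY : 2 ^ n <= e * #|Y|.
  have := card_sumset [set x | x \in C] K; rewrite card_vspace2 dC.
  have := cardsC (sumset [set x | x \in C] K); rewrite card_vec -/Y.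
  move: dK; rewrite expnS.
  have : 0 < 2 ^ i by rewrite expn_gt0.
  move: (2 ^ i) (2 ^ n) #|Y| #|sumset _ _| #|K| => I N y s x I0 h1 h2 h3.
  have : e * s <= e * (I * x) by rewrite leq_mul2l h3 orbT.
  have : N <= I * N by rewrite leq_pmull.
  have : e * N = e * s + e * y by rewrite -h2 mulnDr.
  by lia.
have [b hb] := dense_coset W cY.
have [||b' [W' [W'W dW' bW']]] := HD1 n W _ _ hb; first by rewrite dW.
  by move=> w; rewrite inE => /andP[].
have bY w : w \in W' -> (b + b' + w)%R \in Y.
  by move/bW'; rewrite inE addrA => /andP[].
have bC : (b + b')%R \notin C.
  apply/negP => /(YE _ _ (bY _ (mem0v _))).
  by rewrite addr0 vec_addxx K0.
exists (C + <[(b + b')%R]>)%VS, W'; split=> //.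
- exact: subv_trans WU.
- by rewrite dim_addv_line ?dC.
apply: (avoids_extend av) => // c w cC wW'.
by rewrite addrAC; apply: YE => //; apply: bY.
Qed.

(** * Stability *)

Definition avoids_free n (K : {set vec n}) i k : Prop :=
  forall C W : {vspace vec n}, \dim C = i -> \dim W = k -> ~ avoids K C W.

(* For x outside K with K :&: (K + x) large, K :|: (K + x) is small enough for
   the complement to contain a geometry with one dimension less; adjoining x to
   it gives the forbidden one. *)
Lemma few_large_overlaps t k q : 0 < q -> exists n0, forall n (K : {set vec n}),
  n0 <= n -> 0%R \in K -> 2 ^ t * #|K| <= 2 ^ n -> avoids_free K t.+1 k ->
  q * #|[set x in ~: K | 2 ^ n <= q * #|K :&: shift K x|]| < 2 ^ n.
Proof.
move=> q0; have [D HD] := geometric_erdos_stone k t q0.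
have [D1 HD1] := affine_cube D q0; exists D1 => n K n0 K0 cK fK.
set E := [set x in _ | _]; rewrite ltnNge; apply/negP => cE.
have [||x [U [_ dU xU]]] := HD1 n fullv E _ _ (fun x _ => memvf x); rewrite ?dimv_vec //.
have := xU _ (mem0v U); rewrite addr0 !inE => /andP[xK xE].
have [|||C [W [WU dW dC av]]] := HD n (K :|: shift K x) U.
- by rewrite inE K0.
- by rewrite dU.
(* The union has density at most 2 * 2^-t - 1/q, which is the bound of [geometric_erdos_stone] for
   dimension [t]. *)
- have := cardsUI K (shift K x); rewrite card_shift.
  move: cK xE; move: (2 ^ t) (2 ^ n) #|K :|: _| #|K :&: _| #|K| => T N a b c h1 h2 h3.
  have : q * T * (a + b) = q * T * (c + c) by rewrite h3.
  have : q * (T * c) <= q * N by rewrite leq_mul2l h1 orbT.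
  have : T * N <= T * (q * b) by rewrite leq_mul2l h2 orbT.
  by rewrite !mulnDr; lia.
have avK : avoids K C W.
  by move=> c w cC wW c0; have := av _ _ cC wW c0; rewrite inE negb_or => /andP[].
have x0 : x != 0%R by apply: contraNneq xK => ->.
have xC : x \notin C.
  apply/negP => xC; have := av _ _ xC (mem0v W) x0.
  by rewrite addr0 !inE vec_addxx K0 orbT.
apply: (fK (C + <[x]>)%VS W) => //; first by rewrite dim_addv_line ?dC.
apply: (avoids_extend avK) => // c w cC wW.
(* For c = 0 the vector x + w lies in the cube, hence outside [K]; otherwise c + w is not in K +
   x. *)
have [->|c0] := eqVneq c 0%R.
  by rewrite addr0; have := xU _ (subvP WU _ wW); rewrite !inE => /andP[].
have := av _ _ cC wW c0; rewrite !inE negb_or => /andP[_].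
by rewrite -[(x + c + w)%R]addrA [(x + _)%R]addrC.
Qed.

(** The sum counts the pairs in [K] whose sum leaves [K]. When they are rare, the almost-periods of
    [K] have small doubling and their sumset is the required subspace. *)
Lemma nearly_closed_vspace t n (K : {set vec n}) r : 20 * 2 ^ t.+1 <= r ->
  0%R \in K -> 2 ^ t * #|K| <= 2 ^ n -> r * 2 ^ n <= r * (2 ^ t * #|K|) + 2 ^ n ->
  r * 2 ^ t.+4 * (\sum_(y in K) #|K :&: shift (~: K) y|) <= 2 ^ n * 2 ^ n ->
  exists W : {vspace vec n}, \dim W + t = n /\
    r * #|[set x | x \in W] :\: K| <= 2 * 2 ^ n.
Proof.
move=> hr K0 cK dK hK.
have K_gt0 : 0 < #|K| by apply/card_gt0P; exists 0%R.
have N0 : 0 < 2 ^ n by rewrite expn_gt0.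
have T0 : 0 < 2 ^ t by rewrite expn_gt0.
rewrite !expnS in hr hK.
have dK2 : 2 ^ n <= 2 * (2 ^ t * #|K|).
  move: hr cK dK N0 T0; move: (2 ^ n) (2 ^ t * #|K|) (2 ^ t) => N k T; nia.
(* The translates of [K] by elements of [S] miss at most one eighth of [K]; each element of [K]
   outside [S] causes more than |K|/8 bad pairs. *)
pose S := [set z | 8 * #|K :&: shift (~: K) z| <= #|K|].
have cKS : r * #|K :\: S| <= 2 ^ n.
  have : #|K :\: S| * #|K| <= 8 * \sum_(y in K) #|K :&: shift (~: K) y|.
    rewrite -sum_nat_const big_distrr /= [leqRHS](big_setID S) /=.
    apply: leq_trans (leq_addl _ _); apply: leq_sum => y; rewrite !inE => /andP[+ _].
    by rewrite -ltnNge => /ltnW.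
  move: hK dK2 N0 T0.
  move: (2 ^ n) (2 ^ t) #|K| #|_ :\: _| (\sum_(_ in _) _) => N T k s b h1 h2 N0 T0 h3.
  have a1 : r * T * 2 * (s * k) <= r * T * 2 * (8 * b) by rewrite leq_mul2l h3 orbT.
  have a2 : r * s * N <= r * s * (2 * (T * k)) by rewrite leq_mul2l h2 orbT.
  by rewrite -(leq_pmul2r N0); lia.
have S0 : 0%R \in S.
  rewrite inE (_ : _ :&: _ = set0) ?cards0 //; apply/setP => y.
  by rewrite !inE addr0 andbN.
have KE z : #|K :&: shift K z| + #|K :&: shift (~: K) z| = #|K|.
  rewrite -[RHS](cardsID (shift K z)); congr (_ + #|pred_of_set _|).
  by apply/setP => y; rewrite !inE andbC.
(* A sum of two elements of [S] still has overlap at least 3|K|/4, while all overlaps add up to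
   |K|^2. *)
have cSS : 3 * #|sumset S S| <= 4 * #|K|.
  rewrite -(leq_pmul2r K_gt0) -[4 * _ * _]mulnA -(sum_card_shiftI K K) big_distrr /=.
  rewrite [3 * _]mulnC -mulnA -sum_nat_const big_mkcond; apply: leq_sum => z _.
  case: ifP => // /imset2P[a b]; rewrite !inE => aS bS ->.
  have arith k u v w x : x + w = k -> 8 * u <= k -> 8 * v <= k -> w <= u + v ->
    3 * k <= 4 * x by lia.
  apply: (arith _ _ _ _ _ (KE _) aS bS).
  rewrite -(card_shift (_ :&: shift _ b) a); apply: leq_trans (leq_card_setU _ _).
  apply/subset_leq_card/subsetP => y; rewrite !inE addrA => /andP[-> ->].
  by case: (_ \in K).
have cS : #|K| <= #|S| + #|K :\: S|.
  by rewrite -(cardsID S K) leq_add2r subset_leq_card ?subsetIr.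
have cKS20 : 20 * #|K :\: S| <= #|K|.
  have : 20 * (2 * 2 ^ t) * #|K :\: S| <= r * #|K :\: S| by rewrite leq_mul2r hr orbT.
  move=> h; rewrite -(leq_pmul2l T0); move: h cKS dK2.
  by move: (2 ^ n) (2 ^ t) #|K| #|_ :\: _|; lia.
have [|W WE] := small_doubling_vspace S0.
  by move: cSS cS cKS20 K_gt0; move: #|sumset _ _| #|S| #|K| #|_ :\: _|; lia.
have SW z : z \in S -> z \in W.
  by rewrite WE => zS; apply/imset2P; exists z 0%R; rewrite ?addr0.
have cW : #|sumset S S| = 2 ^ \dim W.
  by rewrite -card_vspace2; apply: eq_card => z; rewrite inE WE.
have SSW : #|S| <= 2 ^ \dim W.
  by rewrite -card_vspace2; apply/subset_leq_card/subsetP => z /SW; rewrite inE.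
(* |W| is within a factor less than 2 of 2^(n-t), and it is a power of 2. *)
have dW : \dim W + t = n.
  apply/eqP; rewrite eqn_leq -ltnS -(@ltn_exp2l 2) // expnD expnS.
  rewrite -[X in _ && X]ltnS -(@ltn_exp2l 2 n) // expnS expnD.
  rewrite -cW in SSW *.
  have hh : 20 * (2 ^ t * #|sumset S S|) >= 19 * (2 ^ t * #|K|).
    by rewrite !(mulnCA _ (2 ^ t)) leq_mul2l; apply/orP; right; lia.
  have h3 : 3 * (2 ^ t * #|sumset S S|) <= 4 * (2 ^ t * #|K|).
    by rewrite !(mulnCA _ (2 ^ t)) leq_mul2l cSS orbT.
  have r20 : 20 <= r by lia.
  rewrite [#|_| * _]mulnC.
  have h4 : 20 * 2 ^ n <= 20 * (2 ^ t * #|K|) + 2 ^ n.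
    move: r20 dK cK; move: (2 ^ n) (2 ^ t * #|K|) => N k; nia.
  by apply/andP; split; lia.
exists W; split=> //.
(* All of [K] except the few elements outside [S] lies in [W], whose size is about |K|. *)
have : #|[set x | x \in W] :\: K| + #|K| <= 2 ^ \dim W + #|K :\: S|.
  rewrite -card_vspace2 -(cardsID K [set x | x \in W]) -(cardsID S K) addnA leq_add2r.
  rewrite addnC leq_add2r; apply/subset_leq_card/subsetP => z.
  by rewrite !inE => /andP[-> zS]; rewrite SW ?inE.
have : 2 ^ n = 2 ^ \dim W * 2 ^ t by rewrite -expnD dW.
move: dK cKS T0; rewrite -(card_vspace2 W).
move: #|_ :\: K| #|[set _ | _]| (2 ^ n) (2 ^ t) #|K| #|_ :\: _|.
move=> a w N T k s h1 h2 T0 h3 h4; rewrite -(leq_pmul2l T0).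
have : r * T * (a + k) <= r * T * (w + s) by rewrite leq_mul2l h4 orbT.
have : T * (r * s) <= T * N by rewrite leq_mul2l h2 orbT.
have : r * N = r * (w * T) by rewrite h3.
have : N <= T * N by rewrite leq_pmull.
by rewrite !mulnDr; lia.
Qed.

Lemma stability t k e : 0 < e -> exists n0, forall n (K : {set vec n}),
  n0 <= n -> 0%R \in K -> 2 ^ t * #|K| <= 2 ^ n -> avoids_free K t.+1 k ->
  exists W : {vspace vec n}, \dim W + t = n /\ e * #|[set x | x \in W] :\: K| <= 2 ^ n.
Proof.
move=> e0; have T0 : 0 < 2 ^ t by rewrite expn_gt0.
pose r := 40 * 2 ^ t * e.
have r0 : 0 < r by rewrite !muln_gt0 T0 e0.
pose q := 2 * (r * 2 ^ t.+4).
have q0 : 0 < q by rewrite muln_gt0 /= muln_gt0 r0 expn_gt0.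
have [n1 H1] := few_large_overlaps t k q0.
have [|D HD] := @geometric_erdos_stone (2 ^ t * r) k t.+1; first by rewrite muln_gt0 T0.
exists (n1 + D) => n K nn K0 cK fK.
have N0 : 0 < 2 ^ n by rewrite expn_gt0.
have := H1 n K (leq_trans (leq_addr _ _) nn) K0 cK fK; set E := [set x in _ | _] => cE.
(* Otherwise [K] has density below 2^-t - 1/(2^t r), and Erdos-Stone in dimension t + 1 gives the
   forbidden geometry. *)
have dK : r * 2 ^ n <= r * (2 ^ t * #|K|) + 2 ^ n.
  rewrite leqNgt; apply/negP => hK.
  have [||C [W [_ dW dC av]]] := HD n K fullv K0; last exact: fK dC dW av.
    by rewrite dimv_vec; lia.
  have : 2 ^ t * (r * (2 ^ t * #|K|) + 2 ^ n) <= 2 ^ t * (r * 2 ^ n).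
    by rewrite leq_mul2l (ltnW hK) orbT.
  by rewrite !expnS !mulnDr; lia.
have [||W [dW cW]] := @nearly_closed_vspace t n K r _ K0 cK dK.
- by rewrite /r expnS; nia.
(* Bad pairs are now counted by their sum x outside [K]. The set [E] has fewer than 2^n/q elements,
   each with at most 2^n pairs; every other x has fewer than 2^n/q pairs. This explains the factor 2
   in [q]. *)
- rewrite sum_card_shiftI_sym.
  have : q * \sum_(x in ~: K) #|K :&: shift K x| <= 2 * (2 ^ n * 2 ^ n).
    rewrite (big_setID E) /= mulnDr mul2n -addnn; apply: leq_add.
      apply: (@leq_trans (q * (#|E| * 2 ^ n))).
        rewrite leq_mul2l -sum_nat_const (setIidPr _); last first.
          by apply/subsetP => x; rewrite inE => /andP[].
        apply/orP; right; apply: leq_sum => x _; rewrite -card_vec; exact: max_card.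
      by rewrite mulnA leq_mul2r (ltnW cE) orbT.
    rewrite big_distrr /= -[X in _ <= X * _]card_vec -sum_nat_const [leqRHS]big_mkcond [leqLHS]big_mkcond.
    apply: leq_sum => x _; case: ifP => //.
    rewrite !inE => /andP[h1 h2]; move: h1; rewrite h2 /= -ltnNge; exact: ltnW.
  by rewrite /q -mulnA leq_pmul2l.
exists W; split => //.
have : e * (40 * 2 ^ t) * #|[set x | x \in W] :\: K| <= 2 * 2 ^ n.
  by move: cW; rewrite /r mulnC [e * _]mulnC [_ * #|_|]mulnC.
move: (2 ^ t) (2 ^ n) #|_ :\: _| T0 => T N a T0 h.
have : 40 * (e * a) <= T * (40 * (e * a)) by rewrite leq_pmull.
by lia.
Qed.

(** Vectors b are added to [C] one at a time, outside W + C and outside (K \ W) + (C + U). The first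
    set fills at most half of the space, the second less than half. Since b + c + u is never in [W],
    it could meet [K] only in K \ W. *)
Lemma greedy_complement n t k (W U : {vspace vec n}) (K : {set vec n}) :
  \dim W + t = n -> (U <= W)%VS -> \dim U = k ->
  2 ^ (t + k).+1 * #|K :\: [set x | x \in W]| <= 2 ^ n ->
  exists2 C : {vspace vec n}, \dim C = t & avoids K C U.
Proof.
move=> dW UW dU hK.
suff: forall i, i <= t -> exists2 C : {vspace vec n}, \dim C = i & avoids K C U by apply.
elim=> [|i IHi] it.
  by exists 0%VS; rewrite ?dimv0 // => c w; rewrite memv0 => ->.
have [C dC av] := IHi (ltnW it).
set B := _ :\: _ in hK.
have [b hb] : exists b, b \notin [set x | x \in (W + C)%VS] :|: sumset B [set x | x \in (C + U)%VS].
  apply: contrapT => /forallNP h.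
  have : 2 ^ n <= #|[set x | x \in (W + C)%VS] :|: sumset B [set x | x \in (C + U)%VS]|.
    rewrite -card_vec -cardsT; apply/subset_leq_card/subsetP => x _.
    by apply/negPn/negP => /h.
  apply/negP; rewrite -ltnNge; apply: leq_ltn_trans (leq_card_setU _ _) _.
  apply: leq_ltn_trans (leq_add (leqnn _) (card_sumset _ _)) _; rewrite !card_vspace2.
  have h1 : 2 ^ \dim (W + C)%VS <= 2 ^ (n.-1).
    rewrite leq_exp2l //; apply: leq_trans (dimv_add_leqif _ _) _; lia.
  have h2 : 2 * 2 ^ \dim (C + U)%VS <= 2 ^ (t + k).
    by rewrite -expnS leq_exp2l //; apply: leq_ltn_trans (dimv_add_leqif _ _) _; lia.
  have h3 : #|B| * (2 * 2 ^ \dim (C + U)%VS) <= #|B| * 2 ^ (t + k) by rewrite leq_mul2l h2 orbT.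
  have n0 : 0 < n by lia.
  have h4 : 2 ^ n = 2 * 2 ^ n.-1 by rewrite -expnS prednK.
  have h5 : 0 < 2 ^ n by rewrite expn_gt0.
  move: hK h1 h3 h4 h5; rewrite [2 ^ _.+1]expnS.
  by move: (2 ^ n) (2 ^ n.-1) (2 ^ (t + k)) (2 ^ _) (2 ^ _) #|B|; lia.
move: hb; rewrite !inE negb_or => /andP[bWC bB].
exists (C + <[b]>)%VS.
  rewrite dim_addv_line ?dC //; apply: contra bWC; apply/subvP/addvSr.
apply: (avoids_extend av) => // c w cC wU.
apply: contra bB => bcw; apply/imset2P; exists (b + c + w)%R (c + w)%R.
- rewrite !inE bcw andbT; apply: contra bWC => h.
  have -> : b = (b + c + w + w + c)%R by rewrite !vec_addrK.
  apply: memv_add => //; apply: memvD => //; exact: (subvP UW).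
- by rewrite inE; apply: memv_add.
- by rewrite -[(b + c + w)%R]addrA vec_addrK.
Qed.

(** * Graphs *)

(** This places the incidence vectors of a forest at chosen elements of [M] and, with empty
    families, parametrises a hyperplane. *)
Lemma extend_free m n (A : seq (vec m)) (B : seq (vec n)) (W : {vspace vec n}) :
  \dim W = m -> free A -> free B -> size B = size A -> {subset B <= W} ->
  exists g : {linear vec m -> vec n},
    [/\ injective g, forall y, y \in W <-> exists x, y = g x & map g A = B].
Proof.
move=> dW fA fB sBA BW.
pose X := A ++ vbasis (<<A>>^C)%VS.
pose Y := B ++ vbasis (W :\: <<B>>)%VS.
have bX : basis_of fullv X.
  rewrite -(addv_complf <<A>>%VS).
  apply: cat_basis; [exact/directv_addP/capv_compl | by rewrite /basis_of eqxx | exact: vbasisP].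
have eW : (<<B>> <= W)%VS by apply/span_subvP.
have bY : basis_of W Y.
  rewrite -[X in basis_of X](_ : (<<B>> + (W :\: <<B>>))%VS = W); last first.
    by rewrite addvC addv_diff; apply/addv_idPl.
  apply: cat_basis; [|by rewrite /basis_of eqxx|exact: vbasisP].
  by apply/directv_addP; rewrite capvC capv_diff.
have sX : size X = m by rewrite -(size_basis (X := in_tuple X) bX) dimv_vec.
have sY : size Y = m by rewrite -dW (size_basis (X := in_tuple Y) bY).
have [g /(_ (basis_free bX))] := linear_of_free X Y; rewrite sX sY => /(_ erefl) gX.
have imgg : limg (linfun g) = W.
  rewrite -(span_basis bX) limg_span -(span_basis bY) -gX; congr <<_>>%VS.
  by apply: eq_map => x; rewrite lfunE.
have g_inj : lker (linfun g) = 0%VS.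
  apply/eqP; rewrite -dimv_eq0 -[lker _]capfv.
  by have := limg_ker_dim (linfun g) fullv; rewrite imgg dW dimv_vec; lia.
exists g; split.
- move=> x y gxy; move/eqP/lker0P: g_inj; apply.
  by rewrite !lfunE.
- move=> y; rewrite -imgg; split=> [/memv_imgP[x _ ->]|[x ->]].
    by exists x; rewrite lfunE.
  by apply/memv_imgP; exists x; rewrite ?memvf ?lfunE.
move: gX; rewrite map_cat => /eqP; rewrite eqseq_cat; first by case/andP=> /eqP.
by rewrite size_map.
Qed.

Section IncidenceVectors.
Variable G : sgraph.
Implicit Types (e : {set G}) (F T : {set {set G}}).
Local Open Scope ring_scope.

(** Any vertex set is allowed: singletons give the unit vectors. *)
Definition incidence e : vec #|G| := \col_i (enum_val i \in e)%:R.

Lemma graphic_matroidE : graphic_matroid G = incidence @: edges G.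
Proof.
have colE j : col j (incidence_matrix G) = incidence (enum_val j).
  by apply/colP => i; rewrite !mxE.
apply/setP => x; apply/imsetP/imsetP => [[j _ ->]|[e eG ->]].
  by exists (enum_val j); rewrite ?colE ?enum_valP.
by exists (enum_rank_in eG e); rewrite ?colE ?enum_rankK_in.
Qed.

Lemma incidence2 u v : u != v ->
  incidence [set u; v] = incidence [set u] + incidence [set v].
Proof.
move=> uv; apply/colP => i; rewrite !mxE !inE.
case: eqVneq => [->|_]; first by rewrite (negbTE uv) addr0.
by rewrite add0r.
Qed.

Lemma adj_neq (u v : G) : adj u v -> u != v.
Proof. by apply: contraTneq => ->; rewrite adj_irrefl. Qed.

Lemma edges_adj (u v : G) : adj u v -> [set u; v] \in edges G.
Proof. by move=> uv; apply/imsetP; exists (u, v); rewrite ?inE. Qed.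

Lemma incidence_adj (u v : G) : adj u v ->
  incidence [set u] + incidence [set v] \in graphic_matroid G.
Proof.
move=> uv; rewrite -incidence2 ?adj_neq // graphic_matroidE.
exact/imset_f/edges_adj.
Qed.

Lemma edges_mem e x : e \in edges G -> x \in e ->
  exists2 y, e = [set x; y] & x != y.
Proof.
case/imsetP=> -[a b]; rewrite inE /= => ab -> /set2P[]->.
  by exists b; rewrite ?adj_neq.
by exists a; rewrite 1?setUC // eq_sym adj_neq.
Qed.

Lemma forest_subset F T : forest F -> T \subset F -> forest T.
Proof.
move=> [FG cF] TF; split; first exact: subset_trans TF FG.
move=> c c2 /andP[cyc Uc]; apply: (cF c c2); apply/andP; split=> //.
by apply: sub_cycle cyc => x y; apply: (subsetP TF).
Qed.

(* All degrees in T are even, so a path in T can always be prolonged. *)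
Lemma forest_sum0 T : forest T -> \sum_(e in T) incidence e = 0 -> T = set0.
Proof.
move=> [TG cT] sum0; apply/eqP/set0Pn => -[e0 e0T].
pose R := [rel x y : G | [set x; y] \in T].
have degree2 x e : e \in T -> x \in e -> exists2 e', e' \in T & (x \in e') && (e' != e).
  move=> eT xe; apply: contrapT => h; have := congr1 (fun M : vec _ => M (enum_rank x) 0) sum0.
  rewrite summxE (bigD1 e) //= big1 => [|e' /andP[e'T e'e]].
    by rewrite !mxE enum_rankK xe addr0.
  rewrite mxE enum_rankK; case: (boolP (x \in e')) => // xe'.
  by case: h; exists e'; rewrite ?xe'.
have step (x y : G) p : uniq [:: x, y & p] -> path R x (y :: p) ->
    exists z, uniq [:: z, x, y & p] /\ path R z [:: x, y & p].
  move=> Up /= /andP[xy yp].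
  have [e' e'T /andP[xe' e'e]] := degree2 x _ xy (set21 _ _).
  have [z ez xz] := edges_mem (subsetP TG _ e'T) xe'.
  have zy : z != y by apply: contraNneq e'e => <-; rewrite ez.
  have zx : R z x by rewrite /= setUC -ez.
  exists z; rewrite /= xy yp -[_ \in T]/(R z x) zx; split=> //.
  (* A neighbour [z] already on the path would close a cycle in [T]. *)
  rewrite -[X in _ && X]/(uniq [:: x, y & p]) Up andbT !inE eq_sym (negbTE xz) (negbTE zy) /=.
  apply/negP => zp; case/splitPr: zp Up yp => p1 p2 Up.
  rewrite cat_path /= => /and3P[yp1 lz _].
  apply: (cT [:: x, y & rcons p1 z]); first by rewrite /= size_rcons.
  apply/andP; split.
    rewrite /= xy rcons_path rcons_path yp1 /= lz last_rcons; exact: zx.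
  by move: Up; rewrite -cat_rcons -!cat_cons cat_uniq => /andP[].
have long m : exists x y p, [/\ uniq [:: x, y & p], path R x (y :: p) & size p = m].
  elim: m => [|m [x [y [p [Up pp sp]]]]].
    have /set0Pn[x xe] : e0 != set0.
      have /imsetP[[a b] _ ->] := subsetP TG _ e0T.
      by apply/set0Pn; exists a; rewrite !inE eqxx.
    have [y ey xy] := edges_mem (subsetP TG _ e0T) xe.
    by exists x, y, [::]; rewrite /= inE xy -ey e0T.
  by have [z [Uz pz]] := step _ _ _ Up pp; exists z, x, (y :: p); split=> //=; rewrite sp.
(* This path has |G| + 2 distinct vertices. *)
have [x [y [p [Up _ sp]]]] := long #|G|.
by have := max_card (mem [:: x, y & p]); rewrite (card_uniqP Up) /= sp => /ltnW; rewrite ltnn.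
Qed.

Lemma span_incidence (s : seq {set G}) x : uniq s -> x \in <<map incidence s>>%VS ->
  exists2 T : {set {set G}}, {subset T <= s} & x = \sum_(e in T) incidence e.
Proof.
elim: s x => [|e s IHs] x /=.
  rewrite span_nil memv0 => _ /eqP->; exists set0; rewrite ?big_set0 // => e.
  by rewrite inE.
move=> /andP[es Us]; rewrite span_cons addvC mem_addv_line.
case/orP=> /(IHs _ Us)[T Ts xE]; first by exists T => // e' /Ts; rewrite inE orbC => ->.
have eT : e \notin T by apply: contra es => /Ts.
exists (e |: T); last by rewrite big_setU1 //= -xE addrC vec_addrK.
by move=> e'; rewrite !inE => /orP[->//|/Ts->]; rewrite orbT.
Qed.

Lemma forest_free F : forest F -> free [seq incidence e | e <- enum F].
Proof.
move=> fF; have : {subset enum F <= F} by move=> e; rewrite mem_enum.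
elim: (enum F) (enum_uniq F) => [|e s IHs] /= => [_ _|]; first exact: nil_free.
move=> /andP[es Us] sF; rewrite free_cons IHs // ?andbT; last first.
  by move=> e' e's; apply: sF; rewrite inE e's orbT.
apply/negP => /(span_incidence Us)[T Ts eE].
have eT : e \notin T by apply: contra es => /Ts.
suff : e |: T = set0 by move/setP/(_ e); rewrite !inE eqxx.
apply: forest_sum0; last by rewrite big_setU1 //= -eE vec_addxx.
apply: forest_subset fF _; apply/subsetP => e'.
rewrite !inE => /orP[/eqP->|/Ts e's]; apply: sF; rewrite inE ?eqxx // e's orbT //.
Qed.

(** The embedding is P + g, where [P] sends the unit vector of v to its colour [cc v] in [C], and
    [g] maps into [W] with the edges of [F] going to [es]. A bichromatic edge lands in the geometry,
    a monochromatic one in [es]. Injectivity holds because [C] and [W] meet trivially. *)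
Lemma graphic_embedding n (M : {set vec n}) (C W : {vspace vec n}) (cc : G -> vec n)
    F (es : seq (vec n)) :
  0 \notin M -> \dim W = #|G| -> avoids (~: M) C W -> (forall v, cc v \in C) ->
  (forall u v : G, adj u v -> cc u = cc v -> [set u; v] \in F) ->
  free [seq incidence e | e <- enum F] ->
  free es -> size es = #|F| -> {subset es <= M} -> {subset es <= W} ->
  has_restriction (graphic_matroid G) M.
Proof.
move=> M0 dW av ccC mono fF fes ses esM esW.
pose P : 'M['F_2]_(n, #|G|) := \matrix_(r, i) cc (enum_val i) r 0.
have PE x : P *m x = \sum_i x i 0 *: cc (enum_val i).
  apply/colP => r; rewrite mxE summxE; apply: eq_bigr => i _.
  by rewrite !mxE mulrC.
have PC x : P *m x \in C by rewrite PE; apply: memv_suml => i _; apply: memvZ.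
have P1 v : P *m incidence [set v] = cc v.
  rewrite PE (bigD1 (enum_rank v)) //= big1 => [|i iv].
    by rewrite mxE enum_rankK inE eqxx scale1r addr0.
  rewrite mxE inE -(inj_eq enum_rank_inj) enum_valK (negbTE iv) scale0r //.
have [|g [g_inj gWP gF]] := extend_free dW fF fes _ esW.
  by rewrite ses size_map -cardE.
have gW x : g x \in W by apply/gWP; exists x.
have CW x : x \in C -> x \in W -> x = 0.
  move=> xC xW; apply/eqP; apply/negPn/negP => x0.
  by have := av _ _ xC xW x0; rewrite vec_addxx inE M0.
exists (mulmx P \+ g); split.
  apply: raddf_inj => x /= /eqP; rewrite addr_eq0 vec_opp => /eqP Pg.
  have gx : g x = 0 by apply: CW => //; rewrite -Pg.
  by apply: g_inj; rewrite gx raddf0.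
apply/subsetP => _ /imsetP[x + ->]; rewrite graphic_matroidE => /imsetP[e'].
case/imsetP=> -[u v]; rewrite inE /= => uv -> ->.
have PEuv : P *m incidence [set u; v] = cc u + cc v.
  by rewrite incidence2 ?adj_neq // mulmxDr !P1.
rewrite PEuv; have [ccE|ccN] := eqVneq (cc u) (cc v).
  rewrite ccE vec_addxx add0r; apply: esM.
  have := mono _ _ uv ccE; set e := [set u; v] => eF.
  have : g (incidence e) \in map g [seq incidence e | e <- enum F].
    by apply: map_f; apply: map_f; rewrite mem_enum.
  by rewrite gF.
have := av (cc u + cc v) (g (incidence [set u; v])) (memvD (ccC u) (ccC v)) (gW _).
by rewrite !inE negbK; apply; rewrite addr_eq0 vec_opp.
Qed.

End IncidenceVectors.

(** * The extremal function *)

Lemma proper_colorable (G : sgraph) (T : finType) (S : {set T}) (c : G -> T) k :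
  (forall v, c v \in S) -> #|S| <= k -> (forall u v : G, adj u v -> c u != c v) ->
  colorable G k.
Proof.
move=> cS Sk cP; apply/existsP.
exists [ffun v => widen_ord Sk (enum_rank_in (cS v) (c v))].
apply/'forall_forallP => u v; apply/implyP => /cP; apply: contra.
rewrite !ffunE -(inj_eq val_inj) /= => /eqP e; apply/eqP.
rewrite -(enum_rankK_in (cS u) (cS u)) -(enum_rankK_in (cS v) (cS v)).
rewrite (enum_val_nth (c v)) (enum_val_nth (c v) (enum_rank_in (cS v) _)).
by rewrite e.
Qed.

Lemma chromatic_numberP (G : sgraph) k : (chromatic_number G <= k) = colorable G k.
Proof.
rewrite /chromatic_number; case: ex_minnP => m cm mP; apply/idP/idP; last exact: mP.
move=> mk; case/existsP: cm => c /'forall_forallP cP.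
apply: (@proper_colorable _ _ setT c); rewrite ?cardsT ?card_ord // => u v uv.
by have /implyP/(_ uv) := cP u v.
Qed.

Lemma vspace_coloring (G : sgraph) n (C : {vspace vec n}) :
  chromatic_number G <= 2 ^ \dim C ->
  exists cc : G -> vec n, (forall v, cc v \in C) /\
    (forall u v : G, adj u v -> cc u != cc v).
Proof.
rewrite chromatic_numberP -card_vspace2 => /existsP[c /'forall_forallP cP].
exists (fun v => enum_val (c v)); split=> [v|u v uv].
  by have := enum_valP (c v); rewrite inE.
by rewrite (inj_eq enum_val_inj); have /implyP/(_ uv) := cP u v.
Qed.

Section Extremal.
Variables (G : sgraph) (t : nat).
Let N := graphic_matroid G.

Lemma ex_number_ge n (M : {set vec n}) :
  matroid M -> restriction_free N M -> #|M| <= ex_number N n.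
Proof.
move=> mM fM; apply: (@leq_bigmax_cond _ _ (fun M : {set vec n} => #|M|)).
by rewrite mM; apply/asboolP.
Qed.

Lemma ex_number_attained n (M0 : {set vec n}) :
  matroid M0 -> restriction_free N M0 ->
  exists M : {set vec n}, [/\ matroid M, restriction_free N M & #|M| = ex_number N n].
Proof.
move=> mM fM.
have [|M] := @eq_bigmax_cond _ [pred M : {set vec n} | matroid M && `[< restriction_free N M >]]
   (fun M : {set vec n} => #|M|).
  by apply/card_gt0P; exists M0; rewrite inE mM; apply/asboolP.
by rewrite inE => /andP[mM' /asboolP fM'] E; exists M; rewrite /ex_number -E.
Qed.

(** An embedding would colour each vertex by the class modulo [W] of the image of its unit vector.
    That uses 2^t colours, and adjacent vertices differ because their edge maps outside [W]. *)
Lemma compl_vspace_free n (W : {vspace vec n}) :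
  2 ^ t < chromatic_number G -> \dim W + t = n ->
  matroid (~: [set x | x \in W]) /\ restriction_free N (~: [set x | x \in W]).
Proof.
move=> chiG dW; split; first by rewrite /matroid !inE mem0v.
case=> f [_ /subsetP fN]; move: chiG; rewrite ltnNge chromatic_numberP => /negP; apply.
pose p := daddv_pi (W^C) W.
have pK x : p x = 0%R -> x \in W.
  have dis : (W^C :&: W = 0)%VS by rewrite capvC capv_compl.
  have xf : x \in (W^C + W)%VS by rewrite addvC addv_complf memvf.
  by have := daddv_pi_add dis xf; rewrite -/p => + px; rewrite px add0r => <-; apply: memv_pi.
apply: (@proper_colorable _ _ [set x | x \in (W^C)%VS] (fun v => p (f (incidence [set v])))).
- by move=> v; rewrite inE memv_pi.
- by rewrite card_vspace2 dimv_compl dimv_vec -{1}dW addKn.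
move=> u v uv; have := fN _ (imset_f f (incidence_adj uv)); rewrite !inE raddfD /=.
apply: contra => /eqP E; apply: pK.
by rewrite raddfD /= E vec_addxx.
Qed.

Lemma spanning_free n (X : seq (vec n)) :
  exists2 s : seq (vec n), {subset s <= X} & free s /\ <<s>>%VS = <<X>>%VS.
Proof.
elim: X => [|x X [s sX [fs sE]]]; first by exists [::]; rewrite ?nil_free.
have [xs|xs] := boolP (x \in <<s>>%VS).
  exists s => [y /sX|]; first by rewrite inE orbC => ->.
  by split=> //; rewrite span_cons -sE; apply/esym/addv_idPr; rewrite -memvE.
exists (x :: s); last by rewrite free_cons xs !span_cons sE.
by move=> y; rewrite !inE => /orP[->//|/sX->]; rewrite orbT.
Qed.

(** A geometry with dim C = t + 1 and dim W = |G| contains M(G) by properly colouring [G], so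
    stability yields [W]. With |F| independent elements of [M] in [W], colouring G - F by a [C] of
    dimension [t] would suffice. *)
Lemma extremal_structure (F : {set {set G}}) :
  chromatic_number G <= 2 ^ t.+1 -> forest F -> chromatic_number (del_edges F) <= 2 ^ t ->
  exists n0, forall n (M : {set vec n}), n0 <= n -> matroid M -> restriction_free N M ->
    2 ^ n <= #|M| + 2 ^ (n - t) ->
    exists W : {vspace vec n}, \dim W + t = n /\
      \dim <<enum (M :&: [set x | x \in W])%SET>>%VS < #|F|.
Proof.
move=> chiG fF chiGF; pose k := #|G|; pose e := 2 ^ (t + k).+1.
have [|n0 Hn0] := @stability t k e; first by rewrite expn_gt0.
exists (n0 + t + k) => n M nn M0 fM cM.
have cKM : #|~: M| + #|M| = 2 ^ n by rewrite addnC cardsC card_vec.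
have nt : 2 ^ n = 2 ^ t * 2 ^ (n - t) by rewrite -expnD subnKC //; lia.
have [||||W [dW cW]] := Hn0 n (~: M).
- by lia.
- by rewrite inE.
- by rewrite nt leq_mul2l; apply/orP; right; lia.
- move=> C W dC dW av; apply: fM.
  have [|cc [ccC ccP]] := @vspace_coloring G n C; first by rewrite dC.
  apply: (@graphic_embedding G n M C W cc set0 [::]) => //; rewrite ?cards0 //.
  + by move=> u v /ccP + /eqP => /negbTE->.
  + by rewrite enum_set0 nil_free.
  + exact: nil_free.
exists W; split=> //; rewrite ltnNge; apply/negP => dF.
have [s sM [fs sE]] := spanning_free (enum (M :&: [set x | x \in W])).
have ss : #|F| <= size s by rewrite -(eqP fs) sE.
pose es := take #|F| s.
have fes : free es by move: fs; rewrite -(cat_take_drop #|F| s) => /catl_free.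
have ses : size es = #|F| by rewrite size_takel.
have esMW x : x \in es -> x \in M /\ x \in W.
  by move/mem_take/sM; rewrite mem_enum !inE => /andP[].
have Fk : #|F| <= k.
  have /eqP := forest_free fF; rewrite size_map -cardE => <-.
  by rewrite -[leqRHS]dimv_vec dimvS ?subvf.
have [||U [esU UW dU]] := @exists_superspace n <<es>>%VS W k.
- by apply/span_subvP => x /esMW[].
- by rewrite (eqP fes) ses Fk; lia.
have [|C dC av] := @greedy_complement n t k W U (~: M) dW UW dU.
  (* Stability bounds W \ K, but the complement of [M] has at most |W| elements, so K \ W is no
     larger. *)
  apply: leq_trans cW; rewrite leq_mul2l; apply/orP; right.
  have := cardsID (~: M) [set x | x \in W]; have := cardsID [set x | x \in W] (~: M).
  rewrite card_vspace2 setIC; have -> : \dim W = n - t by lia.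
  move: cM cKM; move: #|~: M| #|M| (2 ^ n) (2 ^ (n - t)) #|_ :&: _| #|_ :\: ~: M| #|_ :\: _|.
  by lia.
apply: fM; have [|cc [ccC ccP]] := @vspace_coloring (del_edges F) n C; first by rewrite dC.
apply: (@graphic_embedding G n M C U cc F es) => //.
- move=> u v uv /eqP ccE; apply/negPn/negP => uvF.
  by have /ccP : @adj (del_edges F) u v by [apply/andP]; rewrite ccE.
- exact: forest_free.
- by move=> x /esMW[].
- by move=> x xes; apply: (subvP esU); apply: memv_span.
Qed.

(** A hyperplane [H] contains all of [M] that lies in [W], but not [W] itself. Then [M] inside [H]
    is an n-dimensional free matroid, and the rest of [M] avoids both [W] and [H], leaving 2^n -
    2^(n-t) places. *)
Lemma hyperplane_restriction n (M : {set vec n.+1}) (W : {vspace vec n.+1}) :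
  matroid M -> restriction_free N M -> \dim W + t = n.+1 -> t <= n ->
  \dim <<enum (M :&: [set x | x \in W])%SET>>%VS < \dim W ->
  #|M| + 2 ^ (n - t) <= ex_number N n + 2 ^ n.
Proof.
move=> M0 fM dW tn; set L := <<_>>%VS => dL.
have LW : (L <= W)%VS by apply/span_subvP => x; rewrite mem_enum !inE => /andP[].
have [|L' [LL' L'W dL']] := @exists_superspace _ L W (\dim W).-1 LW.
  by rewrite leq_pred andbT -ltnS (ltn_predK dL).
pose H := (L' + W^C)%VS.
have L'C : (L' :&: W^C = 0)%VS.
  by apply/eqP; rewrite -subv0 -(capv_compl W) capvS.
have dH : \dim H = n by rewrite dimv_disjoint_sum // dimv_compl dimv_vec; lia.
have WH : (W + H = fullv)%VS.
  by rewrite addvA (addv_idPl L'W) addv_complf.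
have dWH : \dim (W :&: H) = n - t.
  by have := dimv_sum_cap W H; rewrite WH dimv_vec; lia.
have [//|g [g_inj gH _]] := @extend_free n n.+1 [::] [::] H dH (nil_free _) (nil_free _) erefl.
pose M' := g @^-1: M.
have M'0 : matroid M' by rewrite /matroid inE raddf0.
have fM' : restriction_free N M'.
  case=> f [f_inj fN]; apply: fM; exists (g \o f); split; first exact: inj_comp.
  apply/subsetP => _ /imsetP[x xN ->]; have := subsetP fN _ (imset_f f xN).
  by rewrite inE.
have cM' : #|M'| = #|M :&: [set x | x \in H]|.
  rewrite -(card_imset _ g_inj); apply: eq_card => y; apply/imsetP/idP.
    by case=> x; rewrite !inE => xM ->; rewrite xM; apply/gH; exists x.
  by rewrite !inE => /andP[yM /gH[x yE]]; exists x; rewrite ?inE -?yE.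
have := ex_number_ge M'0 fM'; rewrite cM'.
have c1 := cardsID [set x | x \in H] M.
have c2 : #|M :\: [set x | x \in H]| <= #|~: ([set x | x \in W] :|: [set x | x \in H])|.
  apply/subset_leq_card/subsetP => x; rewrite !inE negb_or => /andP[xH xM].
  rewrite xH andbT; apply: contra xH => xW; apply: (subvP (addvSl L' _)).
  by apply: (subvP LL'); apply: memv_span; rewrite mem_enum !inE xM.
have c3 := cardsC ([set x | x \in W] :|: [set x | x \in H]).
have c4 := cardsUI [set x | x \in W] [set x | x \in H].
have c5 : #|[set x | x \in W] :&: [set x | x \in H]| = 2 ^ (n - t).
  by rewrite -dWH -card_vspace2; apply: eq_card => x; rewrite !inE memv_cap.
move: c3 c4; rewrite c5 card_vec !card_vspace2 dH expnS.
have -> : 2 ^ \dim W = 2 * 2 ^ (n - t) by rewrite -expnS; congr (_ ^ _); lia.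
move: c1 c2; move: (ex_number _ _) #|M| #|_ :&: _| #|_ :\: _| #|~: _| #|_ :|: _|.
by move: (2 ^ n) (2 ^ (n - t)); lia.
Qed.

Lemma ex_number_bounds (F : {set {set G}}) :
  2 ^ t < chromatic_number G <= 2 ^ t.+1 ->
  forest F -> chromatic_number (del_edges F) <= 2 ^ t ->
  exists n0, forall n, n0 <= n ->
    [/\ 2 ^ n <= ex_number N n + 2 ^ (n - t),
        ex_number N n + 2 ^ (n - t) < 2 ^ n + 2 ^ (#|F| - 1)
      & ex_number N n.+1 + 2 ^ (n - t) <= ex_number N n + 2 ^ n].
Proof.
move=> /andP[chiG chiG'] fF chiGF.
have [n0 Hn0] := extremal_structure chiG' fF chiGF.
(* The term |F| makes [W] larger than the span of its part of [M], as the hyperplane argument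
   requires. *)
exists (n0 + t + #|F|).
suff ext n : n0 + t <= n -> exists (M : {set vec n}) (W : {vspace vec n}),
    [/\ matroid M, restriction_free N M, #|M| = ex_number N n,
        2 ^ n <= #|M| + 2 ^ (n - t)
      & \dim W + t = n /\ \dim <<enum (M :&: [set x | x \in W])%SET>>%VS < #|F|].
  move=> n nn; have [|M [W [M0 fM exM cM [dW dF]]]] := ext n; first by lia.
  split; first by rewrite -exM.
    rewrite -exM.
    have := cardsID [set x | x \in W] M.
    have := cardsC [set x | x \in W]; rewrite card_vec card_vspace2.
    have : #|M :\: [set x | x \in W]| <= #|~: [set x | x \in W]|.
      by apply/subset_leq_card/subsetP => x; rewrite !inE => /andP[].
    have : #|M :&: [set x | x \in W]| < 2 ^ (#|F| - 1).
      (* Removing 0 from the span makes the bound strict. *)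
      apply: (@leq_trans (2 ^ \dim <<enum (M :&: [set x | x \in W])%SET>>%VS)).
        rewrite -card_vspace2 [ltnRHS](cardsD1 0%R) inE mem0v add1n ltnS.
        apply/subset_leq_card/subsetP => x xM; rewrite !inE; apply/andP; split.
          by apply: contraTneq xM => ->; rewrite !inE (negbTE M0).
        by apply: memv_span; rewrite mem_enum.
      by rewrite leq_exp2l //; lia.
    have -> : \dim W = n - t by lia.
    move: #|_ :&: _| #|_ :\: _| #|~: _| #|M| (2 ^ n) (2 ^ (n - t)) (2 ^ (#|F| - 1)).
    by lia.
  have [|M' [W' [M0' fM' <- cM' [dW' dF']]]] := ext n.+1; first by lia.
  by apply: (hyperplane_restriction M0' fM' dW'); lia.
move=> nn.
have [W _ dW] := @exists_subspace n fullv (n - t) ltac:(by rewrite dimv_vec leq_subr).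
have dWt : \dim W + t = n by lia.
have [mW fW] := compl_vspace_free chiG dWt.
have [M [M0 fM cM]] := ex_number_attained mW fW.
have cM' : 2 ^ n <= #|M| + 2 ^ (n - t).
  have := ex_number_ge mW fW; have := cardsC [set x | x \in W].
  rewrite card_vec card_vspace2 dW cM.
  by move: #|~: _| (ex_number _ _) (2 ^ n) (2 ^ (n - t)); lia.
by have [|W' hW'] := Hn0 n M _ M0 fM cM'; [lia | exists M, W'].
Qed.

End Extremal.

Lemma nonincreasing_eventually_constant (g : nat -> nat) n0 :
  (forall n, n0 <= n -> g n.+1 <= g n) ->
  exists L n1, forall n, n1 <= n -> g n = L.
Proof.
move=> dec; have exg : exists m, `[< exists2 n, n0 <= n & g n = m >].
  by exists (g n0); apply/asboolP; exists n0.
case: (ex_minnP exg) => L /asboolP[n1 n01 <-] minL; exists (g n1), n1 => n n1n.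
apply/eqP; rewrite eqn_leq minL ?andbT; last first.
  by apply/asboolP; exists n => //; apply: leq_trans n1n.
elim: n n1n => [|n IHn]; first by rewrite leqn0 => /eqP->.
rewrite leq_eqVlt => /orP[/eqP->//|n1n].
exact: leq_trans (dec _ (leq_trans n01 n1n)) (IHn n1n).
Qed.

Theorem theorem1p5 (G : sgraph) (t : nat) :
  2 <= chromatic_number G ->
  2 ^ t < chromatic_number G <= 2 ^ t.+1 ->
  exists l : int, forall F : {set {set G}},
    forest F ->
    chromatic_number (del_edges F) <= 2 ^ t ->
    (l < 2 ^+ (#|F| - 1))%R /\
    exists n0 : nat, forall n : nat, n0 <= n ->
      ((ex_number (graphic_matroid G) n)%:R
        = 2 ^+ n * (1 - 2 ^- t) + l%:~R :> rat)%R.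
Proof.
move=> _ chiG; pose ex n := ex_number (graphic_matroid G) n.
(* The integer is chosen before [F]: one forest [F0] determines it, and without such a forest any
   value will do. *)
have [[F0 fF0 chiF0]|noF] :=
  pselect (exists2 F : {set {set G}}, forest F & chromatic_number (del_edges F) <= 2 ^ t);
  last by exists 0%R => F fF chiF; case: noF; exists F.
have [n0 Hn0] := ex_number_bounds chiG fF0 chiF0.
(* The truncated subtraction is exact here, by the lower bound on [ex]. *)
have [|L [n1 Ln1]] :=
    @nonincreasing_eventually_constant (fun n => ex n + 2 ^ (n - t) - 2 ^ n) (n0 + t).
  move=> n nn; have [|h1 _ h3] := Hn0 n; first by lia.
  have [|h4 _ _] := Hn0 n.+1; first by lia.
  by rewrite /ex subSn ?expnS; [lia | lia].
(* Another forest changes only the threshold, so its own upper bound applies to the same [L]. *)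
exists (Posz L) => F fF chiF; have [n2 Hn2] := ex_number_bounds chiG fF chiF.
have exE n : n1 + n2 + t <= n -> ex n + 2 ^ (n - t) = 2 ^ n + L.
  move=> nn; have [|h1 _ _] := Hn2 n; first by lia.
  by have := Ln1 n; rewrite /ex => <-; lia.
split.
  have [|_ + _] := Hn2 (n1 + n2 + t); first by lia.
  rewrite -/(ex _) exE // ltn_add2l => lL.
  by rewrite -(@natrX int 2) -natz ltr_nat.
exists (n1 + n2 + t) => n nn; have := exE n nn => /(congr1 (fun m : nat => m%:R : rat)%R).
rewrite !natrD !natrX => E; apply: (addIr (2 ^+ (n - t))%R); rewrite {}E.
have -> : ((2 : rat) ^+ (n - t) = 2 ^+ n / 2 ^+ t)%R.
  by rewrite -[in RHS](@subnK t n) ?exprD ?mulfK ?expf_neq0 //; lia.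
by rewrite mulrBr mulr1 addrAC subrK.
Qed.
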